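(* For every integer $d\ge 2$ there exist a $d$-dimensional rectangular box $Q$ and three pairwise distinct types of $d$-dimensional rectangular bricks $A_1,A_2,A_3$ such that $Q$ can be tiled using translates of bricks of the types $A_1,A_2,A_3$, but there is no hyperplane cut of $Q$ into two boxes $Q'$ and $Q''$ together with proper subsets $S',S''\subsetneq\{A_1,A_2,A_3\}$ (possibly different from each other) such that $Q'$ can be tiled using translates of bricks whose types belong to $S'$ and $Q''$ can be tiled using translates of bricks whose types belong to $S''$.
   Context: All boxes and bricks are axis-aligned rectangles in $\mathbb{R}^d$. A brick type is given by its vector of positive real side lengths $(a_1,\ldots,a_d)$, and bricks may only be translated (not rotated), so types are distinct whenever their vectors of side lengths are distinct. A box is tiled using translates of bricks from a given set of types if there is a finite collection of translates of bricks of these types that fill the box completely with no overlaps (i.e. the sum of the indicator functions of the translates equals the indicator function of the box almost everywhere). It is not required that every type in the set be used. A hyperplane cut of an axis-aligned box $Q=\prod_{j=1}^d[p_j,q_j]$ is a separation of $Q$ by a hyperplane $x_j=\alpha$, for some $j\in\{1,\ldots,d\}$ and some $\alpha\in[p_j,q_j]$, into the two axis-aligned boxes $\{x\in Q: x_j\le\alpha\}$ and $\{x\in Q: x_j\ge\alpha\}$. The cases $\alpha=p_j$ and $\alpha=q_j$ are allowed; one of the two boxes then has zero volume and counts as tiled by the empty collection of bricks. *)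

(* Defs.v *)
From HB Require Import structures.
From mathcomp Require Import all_boot all_order all_algebra.
From mathcomp Require Import all_classical all_reals all_analysis.

Set Implicit Arguments.
Unset Strict Implicit.
Unset Printing Implicit Defensive.

Import Order.TTheory GRing.Theory Num.Theory.

Local Open Scope classical_set_scope.
Local Open Scope ring_scope.

(* Points of R^d are row vectors; a brick type is the vector of its side
   lengths. *)

Definition box (R : realType) (d : nat) (p q : 'rV[R]_d) : set 'rV[R]_d :=
  [set x : 'rV[R]_d | forall j, p 0 j <= x 0 j <= q 0 j].

Definition box_volume (R : realType) (d : nat) (p q : 'rV[R]_d) : R :=
  \prod_(j < d) (q 0 j - p 0 j).

(* The library has no d-dimensional Lebesgue measure. Null sets are defined by
   vanishing Lebesgue outer measure: for every e > 0 there is a countable cover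
   by boxes (possibly degenerate) of total volume at most e. *)
Definition lebesgue_null (R : realType) (d : nat) (N : set 'rV[R]_d) : Prop :=
  forall e : R, 0 < e ->
  exists p q : nat -> 'rV[R]_d,
    [/\ forall k j, p k 0 j <= q k 0 j,
        N `<=` \bigcup_k box (p k) (q k) &
        (\sum_(0 <= k <oo) (box_volume (p k) (q k))%:E <= e%:E)%E].

(* A pair b in s is the translate by b.2 of the brick of type b.1. The list s
   may repeat types, and it is allowed to be empty. *)
Definition tileable (R : realType) (d : nat) (S : set 'rV[R]_d)
    (Q : set 'rV[R]_d) : Prop :=
  exists s : seq ('rV[R]_d * 'rV[R]_d),
    (forall b, b \in s -> S b.1) /\
    lebesgue_null
      [set x : 'rV[R]_d |
        \sum_(b <- s) \1_(box b.2 (b.2 + b.1)) x <> \1_Q x :> R].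

(* Main.v *)
Require Import Defs.
From HB Require Import structures.
From mathcomp Require Import all_boot all_order all_algebra.
From mathcomp Require Import all_classical all_reals all_analysis.
From mathcomp Require Import measurable_realfun.
From mathcomp Require Import zify ring lra.
Import Order.TTheory GRing.Theory Num.Theory.
Local Open Scope classical_set_scope.
Local Open Scope ring_scope.

(** The box is [0,7]^2 x [0,1]^(d-2), tiled by the pinwheel: two 5 x 2 bricks
    and two 2 x 5 bricks turning around a central 3 x 3 brick, each of them
    having side 1 in the other directions.

    Every tiling of a box obeys two kinds of identities. The volumes of the
    bricks add up to the volume of the box (null_difference_volume), and along
    some line parallel to a given axis the bricks met by the line exactly fill
    the side of the box (null_difference_line). For the whole box these rule
    out every tiling by two of the types only (needs_three_types): 49 is not a multiple of 10,
    and 7 is not a sum of terms 5 and 3, which are the widths without the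
    2 x 5 type and the heights without the 5 x 2 type. If a cut at position
    alpha leaves two tileable pieces, the line identity makes alpha a natural
    number. In a direction of side 1 this already puts the cut at an end. In a
    direction of side 7 the two pieces have volumes 7 alpha and 7 (7 - alpha),
    both of the form 10 m + 9 n. Their sum 49 is only 10 * 4 + 9, so one piece
    has n = 0, its volume is a multiple of both 7 and 10 below 50, and it is
    zero (cut_at_end). So one piece is the whole box, which needs all three
    types.

    Both identities come from one device. Two finite sums of indicators of
    boxes that agree off a null set differ everywhere by at most a constant
    times the sum of the indicators of a countable cover of that set by boxes
    of small total volume. Such pointwise inequalities between sums of
    indicators survive integration over one coordinate at a time
    (integrate_coordinate), where only the one-dimensional Lebesgue integral
    occurs: all the functions are products of a constant and of the indicator
    of an interval. Integrating over every coordinate gives the volumes, and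
    integrating over one coordinate gives the lengths along the lines parallel
    to its axis. *)

Set Implicit Arguments.
Unset Strict Implicit.
Unset Printing Implicit Defensive.

(** * Integrating sums of indicators of boxes, one coordinate at a time *)

Lemma integral_interval_indicator (R : realType) (c lo hi : R) : 0 <= c ->
  (\int[lebesgue_measure]_u (c * \1_`[lo, hi] u)%:E
   = (c * Num.max (hi - lo) 0)%:E)%E.
Proof.
move=> c0; under eq_integral do rewrite EFinM.
rewrite ge0_integralZl_EFin//; last first.
  by apply/measurable_EFinP.
rewrite integral_indic// setIT.
have := @lebesgue_measure_itv R `[lo, hi]; rewrite /= => ->.
rewrite lte_fin EFinM; congr (_ * _)%E.
case: ltP => h; first by rewrite -EFinB max_l// subr_ge0 ltW.
by rewrite max_r// subr_le0.
Qed.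

(** Here z indexes boxes: [lo z, hi z] is the extent of a box in the coordinate
    being integrated, and c z is the contribution of the other coordinates. *)
Lemma le_integral_interval_indicators (R : realType) (T : Type)
    (s t : seq T) (N : nat -> T) (c lo hi : T -> R) (M : R) :
  (forall z, 0 <= c z) -> 0 <= M ->
  (forall u, ((\sum_(z <- s) c z * \1_`[lo z, hi z] u)%:E <=
     (\sum_(z <- t) c z * \1_`[lo z, hi z] u)%:E +
     M%:E * \sum_(0 <= k <oo) (c (N k) * \1_`[lo (N k), hi (N k)] u)%:E)%E) ->
  ((\sum_(z <- s) c z * Num.max (hi z - lo z) 0)%:E <=
     (\sum_(z <- t) c z * Num.max (hi z - lo z) 0)%:E +
     M%:E * \sum_(0 <= k <oo) (c (N k) * Num.max (hi (N k) - lo (N k)) 0)%:E)%E.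
Proof.
move=> c0 M0 le_st.
pose f z u := (c z * \1_`[lo z, hi z] u)%:E.
have f0 z u : (0 <= f z u)%E by rewrite lee_fin mulr_ge0.
have mf z : measurable_fun setT (f z).
  apply/measurable_EFinP; apply: measurable_funM => //.
pose mu := @lebesgue_measure R.
have intS (r : seq T) : (\int[mu]_u (\sum_(z <- r) f z u) =
    (\sum_(z <- r) c z * Num.max (hi z - lo z) 0)%:E)%E.
  rewrite ge0_integral_sum// -sumEFin; apply: eq_bigr => z _.
  exact: integral_interval_indicator.
have intN : (\int[mu]_u (\sum_(0 <= k <oo) f (N k) u) =
    \sum_(0 <= k <oo) (c (N k) * Num.max (hi (N k) - lo (N k)) 0)%:E)%E.
  rewrite integral_nneseries//; last by move=> n; exact: mf.
  under eq_eseriesr do rewrite integral_interval_indicator//.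
  by [].
have mS (r : seq T) : measurable_fun setT (fun u => \sum_(z <- r) f z u)%E.
  exact: emeasurable_sum.
have mN : measurable_fun setT (fun u => \sum_(0 <= k <oo) f (N k) u)%E.
  exact: ge0_emeasurable_sum.
have N0 u : (0 <= \sum_(0 <= k <oo) f (N k) u)%E by exact: nneseries_ge0.
have S0 (r : seq T) u : (0 <= \sum_(z <- r) f z u)%E by exact: sume_ge0.
rewrite -!intS -intN -ge0_integralZl//.
rewrite -ge0_integralD//; last 3 first.
- exact: mS.
- by move=> u _; rewrite mule_ge0.
- by apply: measurable_funeM; exact: mN.
apply: ge0_le_integral => //.
- exact: mS.
- by apply: emeasurable_funD; [exact: mS|apply: measurable_funeM; exact: mN].
- by move=> u _; rewrite !sumEFin.
Qed.

(** Truncation at 0 makes this the length of the interval even when it is empty,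
    so the integration lemmas need no hypothesis on the order of the corners. *)
Definition side (R : realType) (d : nat) (B : 'rV[R]_d * 'rV[R]_d)
    (j : 'I_d) : R :=
  Num.max (B.2 0 j - B.1 0 j) 0.

(** The integral of the indicator of the box B over the coordinates in J, as a
    function of the coordinates of x outside J. *)
Definition partial_volume (R : realType) (d : nat) (J : {set 'I_d})
    (B : 'rV[R]_d * 'rV[R]_d) (x : 'rV[R]_d) : R :=
  \prod_(j < d)
    (if j \in J then side B j else \1_`[B.1 0 j, B.2 0 j] (x 0 j)).

Lemma side_ge0 (R : realType) (d : nat) (B : 'rV[R]_d * 'rV[R]_d) j :
  0 <= side B j.
Proof. by rewrite /side le_max lexx orbT. Qed.

Lemma partial_volume_ge0 (R : realType) (d : nat) (J : {set 'I_d})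
    (B : 'rV[R]_d * 'rV[R]_d) (x : 'rV[R]_d) : 0 <= partial_volume J B x.
Proof. by apply: prodr_ge0 => j _; case: ifP => _ //; exact: side_ge0. Qed.

Lemma prod_nat_of_bool (R : realType) (I : finType) (P b : pred I) :
  \prod_(i | P i) ((b i)%:R : R) = [forall (i | P i), b i]%:R.
Proof.
case: forallP => [h|/forallP].
  by rewrite big1// => i Pi; have := h i; rewrite Pi /= => ->.
rewrite negb_forall => /existsP[i]; rewrite negb_imply => /andP[Pi /negbTE bi].
by rewrite (bigD1 i)//= bi mul0r.
Qed.

Lemma partial_volume0 (R : realType) (d : nat) (B : 'rV[R]_d * 'rV[R]_d) x :
  partial_volume finset.set0 B x = \1_(box B.1 B.2) x.
Proof.
rewrite /partial_volume.
transitivity (\prod_(j < d) ((B.1 0 j <= x 0 j <= B.2 0 j)%R%:R : R)).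
  by apply: eq_bigr => j _; rewrite finset.inE indicE mem_setE in_itv.
rewrite prod_nat_of_bool indicE; congr (_ %:R); congr nat_of_bool.
apply/idP/idP; first by move=> /forallP h; apply/mem_set => j; exact: h.
by move=> /set_mem h; apply/forallP => j; exact: h.
Qed.

Lemma partial_volumeT (R : realType) (d : nat) (B : 'rV[R]_d * 'rV[R]_d) x :
  (forall j, B.1 0 j <= B.2 0 j) ->
  partial_volume finset.setT B x = box_volume B.1 B.2.
Proof.
move=> le_B; apply: eq_bigr => j _.
by rewrite finset.inE /side max_l// subr_ge0.
Qed.

(** The line through x parallel to the axis j meets the box B, provided the
    side of B along j is not empty. *)
Definition in_line (R : realType) (d : nat) (j : 'I_d) (x : 'rV[R]_d)
    (B : 'rV[R]_d * 'rV[R]_d) : bool :=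
  [forall (i | i != j), B.1 0 i <= x 0 i <= B.2 0 i].

Lemma partial_volume1 (R : realType) (d : nat) (j : 'I_d)
    (B : 'rV[R]_d * 'rV[R]_d) x :
  partial_volume [set j]%SET B x = side B j * (in_line j x B)%:R.
Proof.
rewrite /partial_volume (bigD1 j)//= finset.set11; congr (_ * _).
rewrite -prod_nat_of_bool; apply: eq_bigr => i /negbTE ij.
by rewrite finset.inE ij indicE mem_setE in_itv.
Qed.

(** Once the coordinates of x other than i are fixed, each partial volume is a
    constant times the indicator of an interval in the coordinate i, which
    reduces the claim to dimension one. *)
Lemma integrate_coordinate (R : realType) (d : nat)
    (s t : seq ('rV[R]_d * 'rV[R]_d)) (N : nat -> 'rV[R]_d * 'rV[R]_d) (M : R)
    (J : {set 'I_d}) (i : 'I_d) :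
  0 <= M -> i \notin J ->
  (forall x, ((\sum_(B <- s) partial_volume J B x)%:E <=
     (\sum_(B <- t) partial_volume J B x)%:E +
     M%:E * \sum_(0 <= k <oo) (partial_volume J (N k) x)%:E)%E) ->
  forall x, ((\sum_(B <- s) partial_volume (i |: J)%SET B x)%:E <=
     (\sum_(B <- t) partial_volume (i |: J)%SET B x)%:E +
     M%:E * \sum_(0 <= k <oo) (partial_volume (i |: J)%SET (N k) x)%:E)%E.
Proof.
move=> M0 iJ le_st x.
pose c B : R := \prod_(j < d | j != i)
  (if j \in J then side B j else \1_`[B.1 0 j, B.2 0 j] (x 0 j)).
have c0 B : 0 <= c B.
  by apply: prodr_ge0 => j _; case: ifP => _ //; exact: side_ge0.
have updE u B : partial_volume J B (\row_j if j == i then u else x 0 j) =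
    c B * \1_`[B.1 0 i, B.2 0 i] u.
  rewrite /partial_volume (bigD1 i)//= (negbTE iJ) !mxE eqxx mulrC.
  by congr (_ * _); apply: eq_bigr => j /negbTE ji; rewrite mxE ji.
have intE B : partial_volume (i |: J)%SET B x =
    c B * Num.max (B.2 0 i - B.1 0 i) 0.
  rewrite /partial_volume (bigD1 i)//= finset.setU11 mulrC.
  by congr (_ * _); apply: eq_bigr => j /negbTE ji; rewrite finset.in_setU1 ji.
under eq_bigr do rewrite intE.
under [in X in (_ <= X%:E + _)%E]eq_bigr do rewrite intE.
under eq_eseriesr do rewrite intE.
apply: (@le_integral_interval_indicators _ _ s t N c (fun B => B.1 0 i)
  (fun B => B.2 0 i)) => // u.
have := le_st (\row_j if j == i then u else x 0 j).
under eq_bigr do rewrite updE.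
under [in X in (_ <= X%:E + _)%E]eq_bigr do rewrite updE.
by under eq_eseriesr do rewrite updE.
Qed.

Lemma integrate_coordinates (R : realType) (d : nat)
    (s t : seq ('rV[R]_d * 'rV[R]_d)) (N : nat -> 'rV[R]_d * 'rV[R]_d) (M : R)
    (J K : {set 'I_d}) :
  0 <= M -> J \subset K ->
  (forall x, ((\sum_(B <- s) partial_volume J B x)%:E <=
     (\sum_(B <- t) partial_volume J B x)%:E +
     M%:E * \sum_(0 <= k <oo) (partial_volume J (N k) x)%:E)%E) ->
  forall x, ((\sum_(B <- s) partial_volume K B x)%:E <=
     (\sum_(B <- t) partial_volume K B x)%:E +
     M%:E * \sum_(0 <= k <oo) (partial_volume K (N k) x)%:E)%E.
Proof.
move=> M0 + leJ; move: {2}_.+1 (ltnSn #|K :\: J|%SET) => n.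
elim: n K => // n IHn K ltKn JK.
have [/eqP|[i]] := finset.set_0Vmem (K :\: J)%SET.
  rewrite finset.setD_eq0 => KJ.
  by have /eqP-> : K == J by rewrite finset.eqEsubset KJ JK.
rewrite finset.in_setD => /andP[iJ iK].
move=> x; rewrite -(finset.setD1K iK); apply: integrate_coordinate => //.
  by rewrite finset.in_setD1 eqxx.
apply: IHn; last by rewrite finset.subsetD1 JK.
rewrite (leq_trans _ (ltKn : (_ <= n)%N))//; apply: proper_card.
rewrite finset.setDDl finset.setUC -finset.setDDl.
by rewrite finset.properD1// finset.in_setD iJ.
Qed.

(** * Sums of indicators of boxes that agree up to a null set *)

(** Where the two sums of indicators differ, the sum over s is at most its
    number of terms while the sum over the cover is at least 1. This pointwise
    inequality is then integrated over the coordinates in J. *)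
Lemma null_difference_le (R : realType) (d : nat)
    (s t : seq ('rV[R]_d * 'rV[R]_d)) (N : nat -> 'rV[R]_d * 'rV[R]_d)
    (M : R) (J : {set 'I_d}) x :
  (size s)%:R <= M ->
  [set x | \sum_(B <- s) \1_(box B.1 B.2) x <> \sum_(B <- t) \1_(box B.1 B.2) x
    :> R] `<=` \bigcup_k box (N k).1 (N k).2 ->
  ((\sum_(B <- s) partial_volume J B x)%:E <=
     (\sum_(B <- t) partial_volume J B x)%:E +
     M%:E * \sum_(0 <= k <oo) (partial_volume J (N k) x)%:E)%E.
Proof.
move=> sM stN; have M0 : 0 <= M by apply: le_trans sM.
apply: (@integrate_coordinates _ _ s t N M finset.set0) => //.
  exact: finset.sub0set.
move: x => _ x; under eq_bigr do rewrite partial_volume0.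
under [in X in (_ <= X%:E + _)%E]eq_bigr do rewrite partial_volume0.
under eq_eseriesr do rewrite partial_volume0.
have N0 : (0 <= \sum_(0 <= k <oo) (\1_(box (N k).1 (N k).2) x : R)%:E)%E.
  by apply: nneseries_ge0 => k _ _; rewrite lee_fin.
have [->|/eqP/stN[k _ xNk]] := eqVneq
    (\sum_(B <- s) \1_(box B.1 B.2) x : R) (\sum_(B <- t) \1_(box B.1 B.2) x).
  by rewrite leeDl// mule_ge0// lee_fin.
have s_size : \sum_(B <- s) \1_(box B.1 B.2) x <= (size s)%:R :> R.
  elim: (s) => [|B r IHr]; first by rewrite big_nil.
  by rewrite big_cons /= -natr1 addrC lerD// indicE; case: (_ \in _).
have one_le : (1%:E <= \sum_(0 <= k <oo) (\1_(box (N k).1 (N k).2) x : R)%:E)%E.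
  rewrite (nneseriesD1 (n := k))//.
  have -> : \1_(box (N k).1 (N k).2) x = 1 :> R by rewrite indicE mem_set.
  rewrite leeDl//.
  by apply: nneseries_ge0 => i _ _; rewrite lee_fin.
rewrite (@le_trans _ _ M%:E)//; first by rewrite lee_fin (le_trans s_size).
rewrite -[leLHS]add0e leeD//; first by rewrite lee_fin; apply: sumr_ge0.
by rewrite -[leLHS]mule1 lee_wpmul2l.
Qed.

Lemma null_cover (R : realType) (d : nat)
    (s t : seq ('rV[R]_d * 'rV[R]_d)) (e : R) :
  lebesgue_null [set x | \sum_(B <- s) \1_(box B.1 B.2) x <>
    \sum_(B <- t) \1_(box B.1 B.2) x :> R] -> 0 < e ->
  exists N : nat -> 'rV[R]_d * 'rV[R]_d,
    [/\ [set x | \sum_(B <- s) \1_(box B.1 B.2) x <>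
          \sum_(B <- t) \1_(box B.1 B.2) x :> R]
          `<=` \bigcup_k box (N k).1 (N k).2 &
      forall x,
      (\sum_(0 <= k <oo) (partial_volume finset.setT (N k) x)%:E <= e%:E)%E].
Proof.
move=> null_st e0; have [p [q [le_pq stN Ne]]] := null_st _ e0.
exists (fun k => (p k, q k)); split; first exact: stN.
move=> x.
have volE k : partial_volume finset.setT (p k, q k) x = box_volume (p k) (q k).
  by rewrite partial_volumeT// => j; exact: le_pq.
under eq_eseriesr do rewrite volE.
exact: Ne.
Qed.

(** The error term in the integrated inequality is M times the total volume of
    the cover, and covers of arbitrarily small volume exist. *)
Lemma null_difference_volume (R : realType) (d : nat)
    (s t : seq ('rV[R]_d * 'rV[R]_d)) :
  (forall B, B \in s ++ t -> forall j, B.1 0 j <= B.2 0 j) ->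
  lebesgue_null [set x | \sum_(B <- s) \1_(box B.1 B.2) x <>
    \sum_(B <- t) \1_(box B.1 B.2) x :> R] ->
  \sum_(B <- s) box_volume B.1 B.2 = \sum_(B <- t) box_volume B.1 B.2.
Proof.
move=> ordered null_st.
have volE (r : seq ('rV[R]_d * 'rV[R]_d)) : {subset r <= s ++ t} ->
    \sum_(B <- r) box_volume B.1 B.2 =
    \sum_(B <- r) partial_volume finset.setT B 0.
  move=> r_st; rewrite big_seq [RHS]big_seq; apply: eq_bigr => B Br.
  by rewrite partial_volumeT//; apply: ordered; exact: r_st.
have close e : 0 < e ->
    \sum_(B <- s) box_volume B.1 B.2 <= \sum_(B <- t) box_volume B.1 B.2 + e /\
    \sum_(B <- t) box_volume B.1 B.2 <= \sum_(B <- s) box_volume B.1 B.2 + e.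
  move=> e0; pose M : R := (size s + size t).+1%:R.
  have M0 : 0 < M by rewrite ltr0n.
  have [N [stN Ne]] := null_cover null_st (divr_gt0 e0 M0).
  rewrite !volE; last 2 first.
  - by move=> B Br; rewrite mem_cat Br orbT.
  - by move=> B Br; rewrite mem_cat Br.
  have MN : (M%:E * \sum_(0 <= k <oo)
      (partial_volume finset.setT (N k) 0)%:E <= e%:E)%E.
    rewrite (@le_trans _ _ (M%:E * (e / M)%:E)%E)//.
      by rewrite lee_wpmul2l// lee_fin ltW.
    by rewrite -EFinM lee_fin mulrC divfK// gt_eqF.
  split; rewrite -lee_fin EFinD.
    apply: le_trans (leeD (lexx _) MN).
    by apply: null_difference_le => //; rewrite ler_nat; lia.
  apply: le_trans (leeD (lexx _) MN).
  apply: null_difference_le => //; first by rewrite ler_nat; lia.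
  by move=> x /= ts; apply: stN => /= st; apply: ts.
by apply/eqP; rewrite eq_le; apply/andP; split;
  apply/ler_addgt0Pr => e /close[].
Qed.

(** A finite family has finitely many subset sums, so those different from L
    keep a positive distance from L. *)
Lemma subset_sum_gap (R : realType) (T : Type) (s : seq T) (f : T -> R)
    (L : R) :
  exists2 delta, 0 < delta &
    forall P : pred T, \sum_(z <- s | P z) f z = L \/
      delta <= `|\sum_(z <- s | P z) f z - L|.
Proof.
elim: s L => [|a s IHs] L.
  have [->|L0] := eqVneq L 0.
    by exists 1 => // P; left; rewrite big_nil.
  exists `|L|; first by rewrite normr_gt0.
  by move=> P; right; rewrite big_nil sub0r normrN.
have [e e0 He] := IHs L; have [g g0 Hg] := IHs (L - f a).
exists (Num.min e g); first by rewrite lt_min e0.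
move=> P; rewrite big_cons; case: ifP => _.
  case: (Hg P) => [->|h]; first by left; ring.
  right; rewrite ge_min; apply/orP; right; apply: le_trans h _.
  by rewrite (_ : _ - (L - f a) = f a + \sum_(z <- s | P z) f z - L)//; ring.
case: (He P) => [->|h]; first by left.
by right; rewrite ge_min h.
Qed.

(** If no subset of s had total side equal to that of Q, then by subset_sum_gap
    the boxes of s met by a line through Q would have a total length at distance
    at least delta from the side of Q. On every such line the boxes covering the
    exceptional set would then have a total length bounded below, and
    integrating over the remaining coordinates would bound their total volume
    below as well. *)
Lemma null_difference_line (R : realType) (d : nat)
    (s : seq ('rV[R]_d * 'rV[R]_d)) (Q : 'rV[R]_d * 'rV[R]_d) (j : 'I_d) :
  (forall i, i != j -> Q.1 0 i < Q.2 0 i) ->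
  lebesgue_null [set x | \sum_(B <- s) \1_(box B.1 B.2) x <>
    \sum_(B <- [:: Q]) \1_(box B.1 B.2) x :> R] ->
  exists P, \sum_(B <- s | P B) side B j = side Q j.
Proof.
move=> wide null_sQ; apply/not_existsP => no_sum.
have L0 : 0 < side Q j.
  rewrite lt_neqAle side_ge0 andbT; apply/eqP => L0.
  by apply: (no_sum pred0); rewrite big_pred0.
have Qj : Q.1 0 j < Q.2 0 j.
  by move: L0; rewrite /side lt_max ltxx orbF subr_gt0.
have Qpos i : Q.1 0 i < Q.2 0 i by have [->//|/wide] := eqVneq i j.
have V0 : 0 < box_volume Q.1 Q.2 by apply: prodr_gt0 => i _; rewrite subr_gt0.
have [delta delta0 gap] := subset_sum_gap s (fun B => side B j) (side Q j).
pose M : R := (size s).+1%:R; have M0 : 0 < M by rewrite ltr0n.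
(* With this e the volume of Q would be at most half of itself. *)
pose e := delta * box_volume Q.1 Q.2 / (2 * M * side Q j).
have e0 : 0 < e by rewrite divr_gt0 ?mulr_gt0.
have [N [sQN Ne]] := null_cover null_sQ e0.
(* On each line through Q the cover has total length at least delta / M, so the
   length side Q j is at most C times that of the cover. *)
pose C := M * side Q j / delta.
have C0 : 0 < C by rewrite divr_gt0 ?mulr_gt0.
have line x : ((\sum_(B <- [:: Q]) partial_volume [set j]%SET B x)%:E <=
    (\sum_(B <- [::]) partial_volume [set j]%SET B x)%:E +
    C%:E * \sum_(0 <= k <oo) (partial_volume [set j]%SET (N k) x)%:E)%E.
  have [G0 le_sQ le_Qs] : [/\
      (0 <= \sum_(0 <= k <oo) (partial_volume [set j]%SET (N k) x)%:E)%E,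
      ((\sum_(B <- s) partial_volume [set j]%SET B x)%:E <=
        (\sum_(B <- [:: Q]) partial_volume [set j]%SET B x)%:E +
        M%:E * \sum_(0 <= k <oo) (partial_volume [set j]%SET (N k) x)%:E)%E &
      ((\sum_(B <- [:: Q]) partial_volume [set j]%SET B x)%:E <=
        (\sum_(B <- s) partial_volume [set j]%SET B x)%:E +
        M%:E * \sum_(0 <= k <oo) (partial_volume [set j]%SET (N k) x)%:E)%E].
    split.
    - by apply: nneseries_ge0 => k _ _; rewrite lee_fin partial_volume_ge0.
    - by apply: null_difference_le => //; rewrite ler_nat.
    - apply: null_difference_le => //; first by rewrite ler_nat.
      by move=> y /= ts; apply: sQN => /= st; apply: ts.
  move: G0 le_sQ le_Qs; rewrite big_nil add0e !big_seq1 partial_volume1.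
  have -> : \sum_(B <- s) partial_volume [set j]%SET B x =
      \sum_(B <- s | in_line j x B) side B j.
    rewrite [RHS]big_mkcond; apply: eq_bigr => B _; rewrite partial_volume1.
    by case: in_line; rewrite ?mulr1 ?mulr0.
  move: (\sum_(0 <= k <oo) (partial_volume [set j]%SET (N k) x)%:E)%E.
  move=> [G| |]// G0 le_sQ le_Qs; last first.
    by rewrite gt0_muley ?lte_fin// leey.
  move: G0 le_sQ le_Qs; rewrite -!EFinM -!EFinD !lee_fin => G0.
  have [xQ|xQ] := boolP (in_line j x Q); last first.
    by move=> _ _; rewrite mulr0 mulr_ge0// ltW.
  rewrite mulr1 => le_sQ le_Qs.
  have delta_MG : delta <= M * G.
    have [/no_sum//|h] := gap (in_line j x); apply: le_trans h _.
    by rewrite ler_norml; lra.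
  have -> : C * G = side Q j * (M * G / delta) by rewrite /C; ring.
  by rewrite ler_peMr ?side_ge0// ler_pdivlMr// mul1r.
have := integrate_coordinates (ltW C0) (finset.subsetT [set j]%SET) line 0.
rewrite big_nil add0e big_seq1 partial_volumeT; last by move=> i; exact: ltW.
apply/negP; rewrite -ltNge.
rewrite (@le_lt_trans _ _ (C * e)%:E)//.
  by rewrite (EFinM C e) lee_wpmul2l// lee_fin ltW.
rewrite lte_fin.
have -> : C * e = box_volume Q.1 Q.2 / 2.
  by rewrite /C /e; field; rewrite !gt_eqF.
lra.
Qed.

(** * Numbers of bricks of each type in a pinwheel box *)

Lemma count_types (R : realType) (d : nat) (A1 A2 A3 : 'rV[R]_d)
    (S : set 'rV[R]_d) (s : seq ('rV[R]_d * 'rV[R]_d))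
    (P : pred ('rV[R]_d * 'rV[R]_d)) (f : 'rV[R]_d -> R) (a1 a2 a3 : nat) :
  S `<=` [set A1; A2; A3] -> (forall b, b \in s -> S b.1) ->
  f A1 = a1%:R -> f A2 = a2%:R -> f A3 = a3%:R ->
  exists n1 n2 n3 : nat,
    [/\ \sum_(b <- s | P b) f b.1 = (n1 * a1 + n2 * a2 + n3 * a3)%:R,
        ~ S A1 -> n1 = 0%N, ~ S A2 -> n2 = 0%N & ~ S A3 -> n3 = 0%N].
Proof.
move=> S_A + f1 f2 f3; elim: s => [_|b s IHs Sbs].
  by exists 0%N, 0%N, 0%N; rewrite big_nil.
have [c cs|n1 [n2 [n3 [sumE z1 z2 z3]]]] := IHs.
  by apply: Sbs; rewrite inE cs orbT.
have Sb : S b.1 by apply: Sbs; rewrite mem_head.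
rewrite big_cons; case: ifP => _; last by exists n1, n2, n3.
rewrite sumE; case: (S_A _ Sb) => [[/= bA|/= bA]|/= bA];
  move: Sb; rewrite bA => Sb.
- by exists n1.+1, n2, n3; split=> //; rewrite f1 -natrD; congr (_ %:R); lia.
- by exists n1, n2.+1, n3; split=> //; rewrite f2 -natrD; congr (_ %:R); lia.
- by exists n1, n2, n3.+1; split=> //; rewrite f3 -natrD; congr (_ %:R); lia.
Qed.

(** Coordinates from the third on are 0, as the pinwheel is extended by the
    interval [0, 1] in each of them. *)
Definition corner (R : realType) (d x y : nat) : 'rV[R]_d.+2 :=
  \row_j (nth 0%N [:: x; y] j)%:R.

(** Both the side lengths of a brick and the upper corner of a box whose lower
    corner is in the plane of the pinwheel: from the third coordinate on, the
    entries are 1. *)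
Definition prism (R : realType) (d x y : nat) : 'rV[R]_d.+2 :=
  \row_j (nth 1%N [:: x; y] j)%:R.

Definition pinwheel_types (R : realType) (d : nat) : set 'rV[R]_d.+2 :=
  [set prism R d 5 2; prism R d 2 5; prism R d 3 3].
Arguments pinwheel_types R d : clear implicits.

Lemma prism_gt0 (R : realType) (d x y : nat) j :
  (0 < x)%N -> (0 < y)%N -> 0 < prism R d x y 0 j.
Proof. by move=> x0 y0; rewrite mxE ltr0n; case: j => -[|[|[|n]]]. Qed.

Lemma prod_prism (R : realType) (d x y : nat) :
  \prod_j prism R d x y 0 j = (x * y)%:R.
Proof.
rewrite !big_ord_recl !mxE/= big1 ?mulr1 ?natrM// => i _.
by rewrite mxE /= nth_nil.
Qed.

(** The volume and line identities for the three pinwheel types, with the number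
    of bricks of each type involved. *)
Lemma pinwheel_counts (R : realType) (d : nat) (S : set 'rV[R]_d.+2)
    (p q : 'rV[R]_d.+2) :
  S `<=` pinwheel_types R d -> (forall j, p 0 j <= q 0 j) ->
  tileable S (box p q) ->
  (exists n1 n2 n3 : nat,
    [/\ box_volume p q = (n1 * 10 + n2 * 10 + n3 * 9)%:R,
        ~ S (prism R d 5 2) -> n1 = 0%N, ~ S (prism R d 2 5) -> n2 = 0%N &
        ~ S (prism R d 3 3) -> n3 = 0%N]) /\
  forall j, (forall i, i != j -> p 0 i < q 0 i) ->
  exists n1 n2 n3 : nat,
    [/\ q 0 j - p 0 j = (n1 * nth 1 [:: 5; 2] j + n2 * nth 1 [:: 2; 5] j +
          n3 * nth 1 [:: 3; 3] j)%N%:R,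
        ~ S (prism R d 5 2) -> n1 = 0%N, ~ S (prism R d 2 5) -> n2 = 0%N &
        ~ S (prism R d 3 3) -> n3 = 0%N].
Proof.
move=> S_A le_pq [s [Ss]].
pose toBox (b : 'rV[R]_d.+2 * 'rV[R]_d.+2) := (b.2, b.2 + b.1).
rewrite (_ : [set x | _] = [set x |
    \sum_(B <- map toBox s) \1_(box B.1 B.2) x <>
    \sum_(B <- [:: (p, q)]) \1_(box B.1 B.2) x :> R]); last first.
  by apply/seteqP; split=> x /=; rewrite big_map big_seq1.
move=> null_sQ.
have S_ge0 b : b \in s -> forall j, 0 <= b.1 0 j.
  by move=> /Ss /S_A [[->|->]|->] j; apply/ltW/prism_gt0.
split; last first.
  move=> j wide; have [P] := @null_difference_line _ _ _ (p, q) j wide null_sQ.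
  rewrite big_map /side max_l ?subr_ge0//= => <-.
  rewrite big_seq_cond.
  under eq_bigr => b /andP[bs _].
    rewrite mxE addrAC subrr add0r max_l; last exact: S_ge0.
    over.
  rewrite -big_seq_cond.
  by apply: (@count_types _ _ _ _ _ S s _ (fun A => A 0 j)) => //; rewrite mxE.
have <- : \sum_(B <- map toBox s) box_volume B.1 B.2 = box_volume p q.
  rewrite (null_difference_volume _ null_sQ) ?big_seq1// => B.
  rewrite mem_cat => /orP[/mapP[b bs ->] j|]; last first.
    by rewrite inE => /eqP ->.
  by rewrite /= mxE lerDl S_ge0.
have -> : \sum_(B <- map toBox s) box_volume B.1 B.2 =
    \sum_(b <- s | predT b) \prod_j b.1 0 j.
  rewrite big_map; apply: eq_bigr => b _; apply: eq_bigr => j _.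
  by rewrite /= mxE addrAC subrr add0r.
by apply: (@count_types _ _ _ _ _ S s _ (fun A => \prod_j A 0 j)) => //;
  rewrite prod_prism.
Qed.

(** Without 5 x 2 the heights 5 and 3 cannot add up to 7, without 2 x 5 the same
    holds for the widths, and without 3 x 3 the volume 49 would be a multiple
    of 10. *)
Lemma needs_three_types (R : realType) (d : nat) (S : set 'rV[R]_d.+2) :
  S `<` pinwheel_types R d -> ~ tileable S (box 0 (prism R d 7 7)).
Proof.
move=> [S_A A_S] tile.
have pos j : (0 : 'rV[R]_d.+2) 0 j < prism R d 7 7 0 j.
  by rewrite [ltLHS]mxE prism_gt0.
have [[n1 [n2 [n3 [vol _ _ z3]]]] line] :=
  pinwheel_counts S_A (fun j => ltW (pos j)) tile.
have [m1 [m2 [m3 [width _ y2 _]]]] := line ord0 (fun i _ => pos i).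
have [l1 [l2 [l3 [height x1 _ _]]]] :=
  line (lift ord0 ord0) (fun i _ => pos i).
apply: A_S => _ /= [[->|->]|->]; apply: contrapT.
- move=> /x1 l10; move: height; rewrite !mxE/= subr0 => /eqP.
  by rewrite eqr_nat l10; lia.
- move=> /y2 m20; move: width; rewrite !mxE/= subr0 => /eqP.
  by rewrite eqr_nat m20; lia.
- move=> /z3 n30; move: vol; rewrite /box_volume.
  under eq_bigr do rewrite [X in _ - X]mxE subr0.
  by rewrite prod_prism => /eqP; rewrite eqr_nat n30; lia.
Qed.

(** * Cutting a box *)

Definition set_coord (R : realType) (d : nat) (p : 'rV[R]_d) (j : 'I_d)
    (a : R) : 'rV[R]_d :=
  \row_i if i == j then a else p 0 i.

Lemma box_cut_le (R : realType) (d : nat) (p q : 'rV[R]_d) j a :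
  a <= q 0 j ->
  box p q `&` [set x : 'rV[R]_d | x 0 j <= a] = box p (set_coord q j a).
Proof.
move=> aq; apply/seteqP; split=> x /=.
  move=> [xpq xa] i; have /andP[px xq] := xpq i.
  by rewrite mxE px; case: eqP => [->|_].
move=> xpq; split.
  move=> i; have := xpq i; rewrite mxE; case: eqP => [->|//].
  by move=> /andP[-> /le_trans->].
by have := xpq j; rewrite mxE eqxx => /andP[].
Qed.

Lemma box_cut_ge (R : realType) (d : nat) (p q : 'rV[R]_d) j a :
  p 0 j <= a ->
  box p q `&` [set x : 'rV[R]_d | a <= x 0 j] = box (set_coord p j a) q.
Proof.
move=> pa; apply/seteqP; split=> x /=.
  move=> [xpq xa] i; have /andP[px xq] := xpq i.
  by rewrite mxE xq andbT; case: eqP => [->|_].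
move=> xpq; split.
  move=> i; have := xpq i; rewrite mxE; case: eqP => [->|//].
  by move=> /andP[/(le_trans pa) -> ->].
by have := xpq j; rewrite mxE eqxx => /andP[].
Qed.

Lemma set_coord_id (R : realType) (d : nat) (p : 'rV[R]_d) j :
  set_coord p j (p 0 j) = p.
Proof. by apply/rowP => i; rewrite mxE; case: eqP => [->|]. Qed.

(** Two boxes that agree off the direction j have volumes in the ratio of their
    sides along j; stated without division, as a side may be 0. *)
Lemma box_volume_slab (R : realType) (d : nat) (p q p' q' : 'rV[R]_d) j :
  (forall i, i != j -> p' 0 i = p 0 i /\ q' 0 i = q 0 i) ->
  box_volume p' q' * (q 0 j - p 0 j) =
  box_volume p q * (q' 0 j - p' 0 j).
Proof.
move=> off_j; rewrite /box_volume (bigD1 j)//= [in RHS](bigD1 j)//=.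
rewrite (eq_bigr (fun i => q 0 i - p 0 i)); first by ring.
by move=> i /off_j[-> ->].
Qed.

(** * The pinwheel tiling *)

(** The combinatorial core of the tiling. The variables a0, a2, a5 (c2, c5, c7)
    stand for the first coordinate being at least 0, 2, 5 (at most 2, 5, 7),
    the variables b0, b2, b5, e2, e5, e7 say the same of the second coordinate,
    and r says that the others lie in [0, 1]. The five bricks cover the point
    as often as the big box does, unless the point is in the big box and one of
    its first two coordinates equals 2 or 5. *)
Lemma pinwheel_bool (r a0 a2 a5 c2 c5 c7 b0 b2 b5 e2 e5 e7 : bool) :
  [&& a5 ==> a2, a2 ==> a0, c2 ==> c5, c5 ==> c7, a2 || c2 & a5 || c5] ->
  [&& b5 ==> b2, b2 ==> b0, e2 ==> e5, e5 ==> e7, b2 || e2 & b5 || e5] ->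
  ([&& r, a0, c5, b0 & e2] + [&& r, a5, c7, b0 & e5] +
   [&& r, a2, c7, b5 & e7] + [&& r, a0, c2, b2 & e7] +
   [&& r, a2, c5, b2 & e5] == [&& r, a0, c7, b0 & e7])%N
  || [&& r, a0, c7, b0, e7 &
       [|| a2 && c2, a5 && c5, b2 && e2 | b5 && e5]].
Proof.
case: r => //=.
by move: a5 a2 a0 c2 c5 c7 => [] [] [] [] [] [] //= _;
  move: b5 b2 b0 e2 e5 e7 => [] [] [] [] [] [].
Qed.

Lemma order_consistent (R : realType) (u : R) :
  [&& (5 <= u) ==> (2 <= u), (2 <= u) ==> (0 <= u), (u <= 2) ==> (u <= 5),
      (u <= 5) ==> (u <= 7), (2 <= u) || (u <= 2) & (5 <= u) || (u <= 5)].
Proof.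
rewrite !le_total !andbT; apply/and4P; split; apply/implyP; lra.
Qed.

Definition in_unit_fiber (R : realType) (d : nat) (x : 'rV[R]_d.+2) : bool :=
  [forall j : 'I_d.+2, (1 < j)%N ==> (0 <= x 0 j <= 1)].

Lemma mem_corner_prism (R : realType) (d x1 y1 x2 y2 : nat)
    (z : 'rV[R]_d.+2) :
  (z \in box (corner R d x1 y1) (prism R d x2 y2)) =
  [&& in_unit_fiber z, x1%:R <= z 0 ord0, z 0 ord0 <= x2%:R,
      y1%:R <= z 0 (lift ord0 ord0) & z 0 (lift ord0 ord0) <= y2%:R].
Proof.
apply/idP/idP.
  move=> /set_mem zB; apply/and5P; split.
  - apply/forallP => j; apply/implyP; have := zB j; rewrite !mxE.
    by case: {zB} j => -[|[|n]] jn //=; rewrite !nth_nil.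
  - by have := zB ord0; rewrite !mxE => /andP[].
  - by have := zB ord0; rewrite !mxE => /andP[].
  - by have := zB (lift ord0 ord0); rewrite !mxE => /andP[].
  - by have := zB (lift ord0 ord0); rewrite !mxE => /andP[].
move=> /and5P[/forallP zu z1 z2 z3 z4]; apply/mem_set => j.
have := zu j; case: (j) => -[|[|n]] jn; rewrite !mxE /=.
- by rewrite (_ : Ordinal jn = ord0) ?z1 ?z2//; exact: val_inj.
- by rewrite (_ : Ordinal jn = lift ord0 ord0) ?z3 ?z4//; exact: val_inj.
- by rewrite !nth_nil.
Qed.

Lemma corner_prism (R : realType) (d x y a b : nat) :
  corner R d x y + prism R d a b = prism R d (x + a) (y + b).
Proof.
apply/rowP => j; rewrite !mxE; case: j => -[|[|n]] jn /=; rewrite ?natrD//.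
by rewrite !nth_nil add0r.
Qed.

Lemma corner0 (R : realType) (d : nat) : corner R d 0 0 = 0.
Proof.
by apply/rowP => j; rewrite !mxE; case: j => -[|[|n]]//= _; rewrite nth_nil.
Qed.

(** The faces of the bricks inside the box lie in four hyperplanes, whose
    intersections with the box are boxes of volume 0. *)
Lemma pinwheel_tiling (R : realType) (d : nat) :
  tileable (pinwheel_types R d) (box 0 (prism R d 7 7)).
Proof.
exists [:: (prism R d 5 2, corner R d 0 0); (prism R d 2 5, corner R d 5 0);
           (prism R d 5 2, corner R d 2 5); (prism R d 2 5, corner R d 0 2);
           (prism R d 3 3, corner R d 2 2)].
split.
  move=> b; rewrite !inE => /or4P[/eqP->|/eqP->|/eqP->|/orP[]/eqP->] /=;
    by [left; left|left; right|right].
move=> e e0.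
pose p k : 'rV[R]_d.+2 := match k with
  | 0 => corner R d 2 0 | 1 => corner R d 5 0
  | 2 => corner R d 0 2 | _ => corner R d 0 5 end%N.
pose q k : 'rV[R]_d.+2 := match k with
  | 0 => prism R d 2 7 | 1 => prism R d 5 7
  | 2 => prism R d 7 2 | _ => prism R d 7 5 end%N.
(* The boxes p k, q k from k = 3 on all lie in the hyperplane x_1 = 5. *)
exists p, q; split.
- by case=> [|[|[|k]]] j; rewrite !mxE ler_nat; case: j => -[|[|n]]//= _;
    rewrite !nth_nil.
- move=> z /= /eqP.
  rewrite !big_cons big_nil /= !corner_prism -corner0 !indicE.
  rewrite !mem_corner_prism addr0 -!natrD eqr_nat => ne.
  have := pinwheel_bool (in_unit_fiber z)
    (order_consistent (z 0 ord0)) (order_consistent (z 0 (lift ord0 ord0))).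
  rewrite !addnA in ne *; rewrite (negbTE ne) /=.
  move=> /and5P[z1 z2 z3 z4 /andP[z5]].
  case/or4P => /andP[z6 z7].
  + exists 0%N => //=; apply/set_mem; rewrite mem_corner_prism.
    by rewrite z1 z4 z5 z6 z7.
  + exists 1%N => //=; apply/set_mem; rewrite mem_corner_prism.
    by rewrite z1 z4 z5 z6 z7.
  + exists 2%N => //=; apply/set_mem; rewrite mem_corner_prism.
    by rewrite z1 z2 z3 z6 z7.
  + exists 3%N => //=; apply/set_mem; rewrite mem_corner_prism.
    by rewrite z1 z2 z3 z6 z7.
- rewrite eseries0 ?lee_fin ?ltW// => k _ _; congr (_%:E); apply/eqP.
  rewrite prodf_seq_eq0; apply/hasP.
  case: k => [|[|[|k]]];
   [exists ord0|exists ord0|exists (lift ord0 ord0)|exists (lift ord0 ord0)];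
   by rewrite ?mem_index_enum// !mxE /= subrr.
Qed.

(** * Cuts of the pinwheel box *)

Lemma prism_neq (R : realType) (d x y x' y' : nat) :
  x != x' -> prism R d x y <> prism R d x' y'.
Proof.
move=> xx' /rowP/(_ ord0); rewrite !mxE /= => /eqP; rewrite eqr_nat.
exact/negP.
Qed.

(** The position a is a natural number N by the line identity. When j is one of
    the first two directions, 7 N and 7 (7 - N) are both of the form
    10 m + 9 n, which leaves only N = 0 and N = 7. *)
Lemma cut_at_end (R : realType) (d : nat) (S S' : set 'rV[R]_d.+2)
    (j : 'I_d.+2) (a : R) :
  S `<=` pinwheel_types R d -> S' `<=` pinwheel_types R d ->
  0 <= a <= prism R d 7 7 0 j ->
  tileable S (box 0 (set_coord (prism R d 7 7) j a)) ->
  tileable S' (box (set_coord 0 j a) (prism R d 7 7)) ->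
  a = 0 \/ a = prism R d 7 7 0 j.
Proof.
set Q := prism R d 7 7 => S_A S'_A /andP[a0 aQ] tileS tileS'.
have pos i : 0 < Q 0 i by rewrite prism_gt0.
have le1 i : (0 : 'rV[R]_d.+2) 0 i <= set_coord Q j a 0 i.
  by rewrite !mxE; case: eqP => // _; rewrite ler0n.
have le2 i : set_coord 0 j a 0 i <= Q 0 i.
  by rewrite [leLHS]mxE; case: eqP => [->//|_]; rewrite [leLHS]mxE ltW.
have [[m1 [m2 [m3 [vol1 _ _ _]]]] line] := pinwheel_counts S_A le1 tileS.
have [[n1 [n2 [n3 [vol2 _ _ _]]]] _] := pinwheel_counts S'_A le2 tileS'.
have wide i : i != j -> (0 : 'rV[R]_d.+2) 0 i < set_coord Q j a 0 i.
  by move=> /negbTE ij; rewrite [ltLHS]mxE [ltRHS]mxE ij.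
have [k1 [k2 [k3 [aE _ _ _]]]] := line j wide.
rewrite !mxE eqxx subr0 in aE; move: aE; set N := (_ + _)%N => aN.
have NQ : (N <= nth 1%N [:: 7; 7] j)%N.
  by move: aQ; rewrite aN !mxE ler_nat.
have Qj : Q 0 j = (nth 1%N [:: 7; 7] j)%:R by rewrite mxE.
have volQ : box_volume 0 Q = 49%:R.
  by rewrite /box_volume; under eq_bigr do rewrite [X in _ - X]mxE subr0;
    rewrite prod_prism.
have [j_small|j_big] := ltnP j 2; last first.
  have NQ1 : (N <= 1)%N by move: NQ; rewrite (nth_default _ (s := [:: 7; 7]%N)).
  rewrite Qj aN (nth_default _ (s := [:: 7; 7]%N))//.
  by case: (N) NQ1 => [|[|]]//; [left|right].
have Q7 : nth 1%N [:: 7; 7] j = 7%N by move: j_small; case: (j : nat) => [|[|]].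
rewrite Qj aN Q7.
move: NQ; rewrite Q7 => NQ.
have nat7 (n : nat) (u v : R) : u = n%:R -> u * 7 = 49 * v -> n%:R = 7 * v.
  by move=> ->; lra.
have v1 : (7 * N = m1 * 10 + m2 * 10 + m3 * 9)%N.
  apply/eqP; rewrite -(eqr_nat R) natrM -(nat7 _ _ _ vol1 _)//.
  have := @box_volume_slab _ _ 0 Q 0 (set_coord Q j a) j.
  rewrite volQ Qj Q7 !mxE eqxx !subr0 aN; apply=> i /negbTE ij.
  by split=> //; rewrite [LHS]mxE ij.
have v2 : (7 * (7 - N) = n1 * 10 + n2 * 10 + n3 * 9)%N.
  apply/eqP; rewrite -(eqr_nat R) natrM -(nat7 _ _ _ vol2 _)//.
  have := @box_volume_slab _ _ 0 Q (set_coord 0 j a) Q j.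
  rewrite volQ Qj Q7 !mxE eqxx !subr0 aN natrB//; apply=> i /negbTE ij.
  by split=> //; rewrite [LHS]mxE ij.
have [->|->] : N = 0%N \/ N = 7%N by lia.
  by left.
by right.
Qed.

Lemma no_guillotine_cut (R : realType) (d : nat) (j : 'I_d.+2) (a : R)
    (S S' : set 'rV[R]_d.+2) :
  0 <= a <= prism R d 7 7 0 j ->
  S `<` pinwheel_types R d -> S' `<` pinwheel_types R d ->
  tileable S (box 0 (prism R d 7 7) `&` [set x | x 0 j <= a]) ->
  ~ tileable S' (box 0 (prism R d 7 7) `&` [set x | a <= x 0 j]).
Proof.
move=> a_range S_A S'_A; have /andP[a0 aQ] := a_range.
rewrite box_cut_le// box_cut_ge; last by rewrite mxE.
move=> tileS tileS'.
have [aE|aE] := cut_at_end (properW S_A) (properW S'_A) a_range tileS tileS'.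
  apply: (needs_three_types S'_A); move: tileS'.
  by have := set_coord_id (0 : 'rV[R]_d.+2) j; rewrite mxE aE => ->.
by apply: (needs_three_types S_A); move: tileS; rewrite aE set_coord_id.
Qed.

Unset Implicit Arguments.

Theorem mainTheorem1 (R : realType) (d : nat) (hd : (2 <= d)%N) :
  exists p q A1 A2 A3 : 'rV[R]_d,
    [/\ forall j, p 0 j < q 0 j,
        forall j, [/\ 0 < A1 0 j, 0 < A2 0 j & 0 < A3 0 j],
        [/\ A1 <> A2, A1 <> A3 & A2 <> A3],
        tileable [set A1; A2; A3] (box p q) &
        ~ exists (j : 'I_d) (alpha : R) (S' S'' : set 'rV[R]_d),
            [/\ p 0 j <= alpha <= q 0 j,
                S' `<` [set A1; A2; A3],
                S'' `<` [set A1; A2; A3],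
                tileable S' (box p q `&` [set x : 'rV[R]_d | x 0 j <= alpha]) &
                tileable S'' (box p q `&` [set x : 'rV[R]_d | alpha <= x 0 j])]].
Proof.
case: d hd => [|[|d]]// _.
exists 0, (prism R d 7 7), (prism R d 5 2), (prism R d 2 5), (prism R d 3 3).
split.
- by move=> j; rewrite [ltLHS]mxE prism_gt0.
- by move=> j; rewrite !prism_gt0.
- by split; exact: prism_neq.
- exact: pinwheel_tiling.
- move=> [j [alpha [S' [S'' [alpha_range S'_A S''_A tileS']]]]].
  rewrite [X in X <= _]mxE in alpha_range.
  exact: (no_guillotine_cut alpha_range S'_A S''_A tileS').
Qed.
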